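(* Let $M$ be a connected oriented 3-manifold, the interior of a compact manifold $\overline M$ whose boundary consists of $n_{\mathfrak c}\ge 1$ tori, with an ideal triangulation with $n$ tetrahedra (hence $n$ ideal edges). Let $C_1,\dots,C_{n-n_{\mathfrak c}}$ be edge curves of distinct ideal edges, $\Gamma_1,\dots,\Gamma_{n-n_{\mathfrak c}}$ oscillating curves that are symplectic duals to them, and $\mathfrak m_1,\mathfrak l_1,\dots,\mathfrak m_{n_{\mathfrak c}},\mathfrak l_{n_{\mathfrak c}}$ boundary curves forming a symplectic basis for $H_1(\partial\overline M)$, so that $\omega(h(C_i),h(\Gamma_j))=2\delta_{ij}$, $\omega(h(\mathfrak m_i),h(\mathfrak l_j))=2\delta_{ij}$, and $\omega$ vanishes on the holonomies of every other pair of these curves. Let $SY$ be the $2n\times 2n$ matrix whose rows correspond to the gluing equations (the $C_i$), their symplectic duals arising from oscillating curves (the $\Gamma_i$), and the curves $\mathfrak m_i,\mathfrak l_i$. Then a solution $Z$ to the gluing and cusp equations satisfies $$2Z=i\pi\,\bigl(-J\,(SY)^T J\bigr)\,\overline C .$$ Here $\overline C$, $SY$, $J$ are all integral matrices, so the solutions are integer or half-integer multiples of $i\pi$.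
   Context: **Triangulation and labels.** $\overline M$ is a compact connected oriented 3-manifold with nonempty boundary, $M$ its interior, obtained from oriented ideal tetrahedra $t_1,\dots,t_n$ (vertices removed) by gluing all faces in pairs by orientation-reversing maps; truncating the ideal vertices decomposes $\overline M$ into truncated tetrahedra. Label the edges of each $t_i$ by $a,b,c$ so that opposite edges have the same label and the three edges at each vertex are labelled $a,b,c$ in anticlockwise order viewed from outside. The truncated $t_i$ has four triangular faces $\Delta$ (one per ideal vertex; together these triangulate $\partial\overline M$) and four hexagonal faces $F$ (one per face of $t_i$). Corners of $\Delta$ are labelled $a,b,c$ by the edge of $t_i$ ending there; the side of $\Delta$ between corners $a,b$ is labelled $ab$, similarly $bc$, $ca$. A hexagon $F$ has three short sides (sides of triangles), carrying labels $ab,bc,ca$, alternating with three long sides (along edges of $t_i$). If $F$ is glued to $\widehat F$, the short side $k$ of $F$ is glued to a short side of $\widehat F$ whose label is denoted $\widehat k$. **Train track $\tau$.** Its oriented branches are, with $k\neq l$ in $\{ab,bc,ca\}$: for each $\Delta$, $\gamma_{\Delta(a)},\gamma_{\Delta(b)},\gamma_{\Delta(c)},\gamma_{\Delta(ab)},\gamma_{\Delta(bc)},\gamma_{\Delta(ca)}$; for each $F$, $\gamma_{F(k)}$ and $\gamma_{F(k,l)}$. Vertices: (1) for each side $k$ of each $\Delta$, a 2-switch with $\gamma_{\Delta(k)}$ on one side and the two branches $\gamma_{\Delta(x)}$, $x$ a letter of $k$, on the other, where $\gamma_{\Delta(x)}$ joins the switches on the two sides of $\Delta$ meeting at corner $x$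 and is oriented anticlockwise around that corner; (2) for each short side $k$ of $F$, being the side $k$ of $\Delta$, a 3-switch with $\gamma_{\Delta(k)}$ on one side and $\gamma_{F(k)},\gamma_{F(k,l)},\gamma_{F(k,m)}$ on the other ($\{k,l,m\}=\{ab,bc,ca\}$); (3) for each pair of glued short sides $k,\widehat k$ of $F,\widehat F$, a 1-switch with $\gamma_{F(k)}$ on one side and $\gamma_{\widehat F(\widehat k)}$ on the other; (4) for each pair of glued long sides, between short sides $k,l$ of $F$ and $\widehat k,\widehat l$ of $\widehat F$, a station with $\gamma_{F(k,l)},\gamma_{\widehat F(\widehat k,\widehat l)}$ at one end and $\gamma_{F(l,k)},\gamma_{\widehat F(\widehat l,\widehat k)}$ at the other. Orientations: $\gamma_{\Delta(k)}$ goes from 2-switch to 3-switch, $\gamma_{F(k)}$ from 3-switch to 1-switch, $\gamma_{F(k,l)}$ from 3-switch to station. **Oscillating curves.** An oscillating curve is a cyclic sequence $v_0,\gamma_0,v_1,\gamma_1,\dots,v_N=v_0$ of vertices and branches, each $\gamma_j$ having ends $v_j,v_{j+1}$ and equipped with an orientation, called forwards if from $v_j$ to $v_{j+1}$ and backwards otherwise, such that: at a switch $v_j$, $\gamma_{j-1},\gamma_j$ are on opposite sides and are both forwards or both backwards; at a station, if $\gamma_{j-1},\gamma_j$ are at the same end they are both forwards or both backwards, and if at opposite ends then one is forwards and one backwards. It determines $\sum_\gamma n_\gamma\gamma$, with $n_\gamma$ the number of passages over $\gamma$ whose chosen orientation agrees with that of $\gamma$ in $\tau$ minus the number that disagree.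 The edge curve of an ideal edge $E$ is the oscillating curve encircling once, anticlockwise, a vertex $v$ of the triangulation of $\partial\overline M$ which is an end of $E$: it passes over $\gamma_{\Delta(x)}$ for each corner $x$ of a triangle $\Delta$ at $v$, and between consecutive triangles over $\gamma_{\Delta(k)},\gamma_{F(k)},\gamma_{\widehat F(\widehat k)},\gamma_{\widehat\Delta(\widehat k)}$ across their common side. A boundary curve is an oscillating curve using no branch $\gamma_{F(k,l)}$. **Symplectic space, holonomy.** $\mathcal V$ is the real vector space generated by $\mathbf a_i,\mathbf b_i,\mathbf c_i$ ($1\le i\le n$) subject to $\mathbf a_i+\mathbf b_i+\mathbf c_i=0$, with $\omega(\mathbf a_i,\mathbf b_j)=\omega(\mathbf b_i,\mathbf c_j)=\omega(\mathbf c_i,\mathbf a_j)=\delta_{ij}$, antisymmetric. $h(\sum n_\gamma\gamma)=\sum n_\gamma h(\gamma)$ with $h(\gamma_{\Delta(a)})=\mathbf a_i$, $h(\gamma_{\Delta(b)})=\mathbf b_i$, $h(\gamma_{\Delta(c)})=\mathbf c_i$ for $\Delta$ a triangular face of the truncated $t_i$, and $h(\gamma)=0$ for other branches. **Matrices and equations.** The incidence vector of an oscillating curve is $(p_1,q_1,r_1,\dots,p_n,q_n,r_n)\in\mathbb Z^{3n}$, where $p_j,q_j,r_j$ are the sums over the four triangular faces $\Delta$ of the truncated $t_j$ of $n_{\Delta(a)},n_{\Delta(b)},n_{\Delta(c)}$ respectively. Its row is $(p_1-r_1,q_1-r_1,\dots,p_n-r_n,q_n-r_n)\in\mathbb Z^{2n}$.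 $SY$ has as rows the rows of the curves in the order $C_1,\Gamma_1,C_2,\Gamma_2,\dots,\mathfrak m_1,\mathfrak l_1,\mathfrak m_2,\mathfrak l_2,\dots$, and $NZ$ is the submatrix of rows of the $C_i,\mathfrak m_i,\mathfrak l_i$. The (logarithmic) gluing equation of $C_i$ reads $\sum_j(p_jZ_j+q_jZ_j'+r_jZ_j'')=2\pi i$, the cusp equation of $\mathfrak m_i$ or $\mathfrak l_i$ reads $\sum_j(p_jZ_j+q_jZ_j'+r_jZ_j'')=0$, and $Z_j+Z'_j+Z''_j=i\pi$; eliminating $Z''_j$, the gluing and cusp equations become $NZ\cdot Z=i\pi C^\flat$ for $Z=(Z_1,Z_1',\dots,Z_n,Z_n')^T$, where the entry of $C^\flat$ is $2-\sum_jr_j$ in the row of $C_i$ and $-\sum_jr_j$ in the rows of $\mathfrak m_i,\mathfrak l_i$. $\overline C$ is $C^\flat$ extended by entries $0$ in the rows of the $\Gamma_i$; the paper takes the gluing and cusp equations, augmented in this way, in the form $SY\cdot Z=i\pi\overline C$. $J$ is the $2n\times2n$ block-diagonal matrix with blocks $\begin{pmatrix}0&1\\-1&0\end{pmatrix}$. *)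

(* Defs.v *)
From HB Require Import structures.
From mathcomp Require Import all_boot all_order all_fingroup all_algebra.
From mathcomp Require Import reals trigo.
From mathcomp Require Import complex.

Set Implicit Arguments.
Unset Strict Implicit.
Unset Printing Implicit Defensive.

Import Order.TTheory GRing.Theory Num.Theory.
Local Open Scope ring_scope.

Inductive letter := La | Lb | Lc.
Inductive side := AB | BC | CA.

Definition letter_code (x : letter) : option bool :=
  match x with La => None | Lb => Some true | Lc => Some false end.
Definition letter_decode (o : option bool) : letter :=
  match o with None => La | Some true => Lb | Some false => Lc end.
Lemma letter_codeK : cancel letter_code letter_decode. Proof. by case. Qed.
HB.instance Definition _ := Finite.copy letter (can_type letter_codeK).

Definition opp_corner (k : side) : letter :=
  match k with AB => Lc | BC => La | CA => Lb end.
Definition opp_side (x : letter) : side :=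
  match x with La => BC | Lb => CA | Lc => AB end.
Lemma opp_cornerK : cancel opp_corner opp_side. Proof. by case. Qed.
HB.instance Definition _ := Finite.copy side (can_type opp_cornerK).

(* The corners a, b, c of a triangle are in anticlockwise order, so an
   anticlockwise arc around corner a runs from side ab to side ca, etc. *)
Definition side_in (x : letter) : side :=
  match x with La => AB | Lb => BC | Lc => CA end.
Definition side_out (x : letter) : side :=
  match x with La => CA | Lb => AB | Lc => BC end.

(* The vertices of each tetrahedron are numbered so that the edges 01, 23 are
   labelled a, the edges 02, 13 are labelled b, the edges 03, 12 are labelled c.
   The orientation is the one for which the edges 01, 02, 03 are in
   anticlockwise order at vertex 0 viewed from outside; this then holds for
   the edges labelled a, b, c at each vertex.  Every labelling of an oriented
   tetrahedron, opposite edges having the same label and a, b, c being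
   anticlockwise at each vertex, is of this form for some numbering of its
   vertices.  Then across x v is the other end of the edge labelled x at the
   vertex v. *)
Definition across (x : letter) (v : 'I_4) : 'I_4 :=
  let v0 := @Ordinal 4 0 isT in let v1 := @Ordinal 4 1 isT in
  let v2 := @Ordinal 4 2 isT in let v3 := @Ordinal 4 3 isT in
  tnth match x with
       | La => [tuple v1; v0; v3; v2]
       | Lb => [tuple v2; v3; v0; v1]
       | Lc => [tuple v3; v2; v1; v0]
       end v.

(* The label of the edge vw, for v != w. *)
Definition edge_label (v w : 'I_4) : letter :=
  if across La v == w then La else if across Lb v == w then Lb else Lc.

(* The face f of the tetrahedron t is the face opposite to the vertex f.  It is
   glued to the face glue t f f of the tetrahedron nbr t f, and the vertices
   v != f of the face are sent to glue t f v.  As all tetrahedra carry the same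
   orientation in terms of the numbering of their vertices, the gluing map of
   faces reverses orientation if and only if the permutation is odd. *)
Record triangulation (n : nat) := Triangulation {
  nbr : 'I_n -> 'I_4 -> 'I_n;
  glue : 'I_n -> 'I_4 -> {perm 'I_4};
  nbr_invol : forall t f, nbr (nbr t f) (glue t f f) = t;
  glue_invol : forall t f, glue (nbr t f) (glue t f f) = (glue t f)^-1%g;
  glue_nofix : forall t f, (nbr t f, glue t f f) != (t, f);
  glue_odd : forall t f, odd_perm (glue t f)
}.

Section Triangulation.
Variables (n : nat) (T : triangulation n).

Definition connected_triangulation : Prop :=
  forall t u : 'I_n, connect [rel t u | [exists f, nbr T t f == u]] t u.

(* (t, v) is the triangular face of the truncated t at its vertex v, and
   (t, f) is also the hexagonal face lying in the face f of t. *)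
Definition triangle : finType := ('I_n * 'I_4)%type.
Definition hexagon : finType := ('I_n * 'I_4)%type.
Definition tcorner : finType := (triangle * letter)%type.
Definition tside : finType := (triangle * side)%type.
Definition short_side : finType := (hexagon * side)%type.
(* (F, k, l) is the long side of F between its short sides k and l, directed
   from k to l; only pairs k != l are relevant. *)
Definition long_end : finType := (short_side * side)%type.

(* The side k of the triangle (t, v) is the short side k of the hexagon in the
   face containing the two corners of k, i.e. opposite to the remaining one;
   conversely the short side k of (t, f) lies in the triangle at the vertex
   joined to f by the edge with the label not occurring in k. *)
Definition short_of_tside (s : tside) : short_side :=
  let: ((t, v), k) := s in ((t, across (opp_corner k) v), k).
Definition tside_of_short (s : short_side) : tside :=
  let: ((t, f), k) := s in ((t, across (opp_corner k) f), k).

Definition glue_short (s : short_side) : short_side :=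
  let: ((t, f), k) := s in
  let v := across (opp_corner k) f in
  ((nbr T t f, glue T t f f),
   opp_side (edge_label (glue T t f f) (glue T t f v))).
Definition glue_tside (s : tside) : tside :=
  tside_of_short (glue_short (short_of_tside s)).

Definition long_swap (e : long_end) : long_end :=
  let: ((h, k), l) := e in ((h, l), k).
Definition glue_long (e : long_end) : long_end :=
  let: ((h, k), l) := e in (glue_short (h, k), (glue_short (h, l)).2).

(* The corner of the next triangle, anticlockwise, around the vertex of the
   triangulation of the boundary at which the given corner lies. *)
Definition next_corner (c : tcorner) : tcorner :=
  let: ((t, v), x) := c in
  let f := across (opp_corner (side_out x)) v in
  let v' := glue T t f v in
  ((nbr T t f, v'), edge_label v' (glue T t f (across x v))).

(* The components of the boundary are the connected components of the
   adjacency relation of triangles; the vertices, resp. edges, of the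
   triangulation of the boundary are the orbits of next_corner on corners,
   resp. of glue_tside on sides of triangles. *)
Definition tri_adj : rel triangle :=
  [rel d d' | [exists k, (glue_tside (d, k)).1 == d']].
Definition boundary_component (d : triangle) : {set triangle} :=
  [set d' | connect tri_adj d d'].
Definition euler_char (S : {set triangle}) : int :=
  (fcard next_corner [pred c : tcorner | c.1 \in S])%:Z
  - (fcard glue_tside [pred s : tside | s.1 \in S])%:Z
  + #|S|%:Z.

(* A component of the boundary is a closed connected oriented surface, hence a
   torus if and only if its Euler characteristic vanishes. *)
Definition boundary_tori (nc : nat) : Prop :=
  n_comp tri_adj predT = nc /\
  forall d, euler_char (boundary_component d) = 0.

(* The branches of the train track: Bcorner (D, x) is gamma_{D(x)},
   Bside (D, k) is gamma_{D(k)}, Bshort (F, k) is gamma_{F(k)} and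
   Blong ((F, k), l) is gamma_{F(k, l)}, which requires k != l. *)
Inductive branch :=
  | Bcorner of tcorner
  | Bside of tside
  | Bshort of short_side
  | Blong of long_end.

Definition branch_code (g : branch) :
    tcorner + tside + (short_side + long_end) :=
  match g with
  | Bcorner c => inl (inl c) | Bside s => inl (inr s)
  | Bshort s => inr (inl s) | Blong e => inr (inr e)
  end.
Definition branch_decode (u : tcorner + tside + (short_side + long_end)) :=
  match u with
  | inl (inl c) => Bcorner c | inl (inr s) => Bside s
  | inr (inl s) => Bshort s | inr (inr e) => Blong e
  end.
Lemma branch_codeK : cancel branch_code branch_decode. Proof. by case. Qed.
HB.instance Definition _ := Finite.copy branch (can_type branch_codeK).

Definition is_branch (g : branch) : bool :=
  if g is Blong ((_, k), l) then k != l else true.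
Definition is_Bside (g : branch) : bool := if g is Bside _ then true else false.
Definition is_Blong (g : branch) : bool := if g is Blong _ then true else false.

(* A 1-switch is given by the pair of glued short sides, and a station by the
   pair of glued long sides, each with its two directions. *)
Inductive vertex :=
  | Switch2 of tside
  | Switch3 of short_side
  | Switch1 of {set short_side}
  | Station of {set long_end}.

Definition vertex_code (v : vertex) :
    tside + short_side + ({set short_side} + {set long_end}) :=
  match v with
  | Switch2 s => inl (inl s) | Switch3 s => inl (inr s)
  | Switch1 A => inr (inl A) | Station A => inr (inr A)
  end.
Definition vertex_decode
    (u : tside + short_side + ({set short_side} + {set long_end})) :=
  match u with
  | inl (inl s) => Switch2 s | inl (inr s) => Switch3 s
  | inr (inl A) => Switch1 A | inr (inr A) => Station A
  end.
Lemma vertex_codeK : cancel vertex_code vertex_decode. Proof. by case. Qed.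
HB.instance Definition _ := Equality.copy vertex (can_type vertex_codeK).

Definition is_station (v : vertex) : bool :=
  if v is Station _ then true else false.

Definition switch1_of (s : short_side) : vertex :=
  Switch1 [set s; glue_short s].
Definition station_of (e : long_end) : vertex :=
  Station [set e; long_swap e; glue_long e; long_swap (glue_long e)].

(* The initial and final vertices of a branch, for its orientation in tau. *)
Definition branch_src (g : branch) : vertex :=
  match g with
  | Bcorner (d, x) => Switch2 (d, side_in x)
  | Bside s => Switch2 s
  | Bshort s => Switch3 s
  | Blong (s, _) => Switch3 s
  end.
Definition branch_tgt (g : branch) : vertex :=
  match g with
  | Bcorner (d, x) => Switch2 (d, side_out x)
  | Bside s => Switch3 (short_of_tside s)
  | Bshort s => switch1_of s
  | Blong e => station_of e
  end.

(* Whether two branches incident to v are on the same side of the switch v,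
   resp. at the same end of the station v. *)
Definition same_side (v : vertex) (g g' : branch) : bool :=
  match v with
  | Switch2 _ | Switch3 _ => is_Bside g == is_Bside g'
  | Switch1 _ => g == g'
  | Station _ =>
      match g, g' with
      | Blong e, Blong e' => (e' == e) || (e' == glue_long e)
      | _, _ => false
      end
  end.

(* A passage v_j, gamma_j, v_(j+1) of a curve.  No branch is a loop, so v_j and
   v_(j+1) are recorded by the direction of travel along gamma_j (along means
   from its source to its target in tau); forwards says whether the orientation
   chosen on gamma_j is from v_j to v_(j+1). *)
Record passage := Passage { pbranch : branch; along : bool; forwards : bool }.

Definition vertex_before (s : passage) : vertex :=
  if along s then branch_src (pbranch s) else branch_tgt (pbranch s).
Definition vertex_after (s : passage) : vertex :=
  if along s then branch_tgt (pbranch s) else branch_src (pbranch s).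

Definition follows (s s' : passage) : bool :=
  let v := vertex_after s in
  let same := same_side v (pbranch s) (pbranch s') in
  let same_dir := forwards s == forwards s' in
  (vertex_before s' == v) &&
  (if is_station v then same_dir == same else ~~ same && same_dir).

Definition curve : Type := seq passage.

Definition oscillating (C : curve) : Prop :=
  [/\ (0 < size C)%N, all (fun s => is_branch (pbranch s)) C &
      path.cycle follows C].

Definition boundary_curve (C : curve) : Prop :=
  oscillating C /\ all (fun s => ~~ is_Blong (pbranch s)) C.

(* n_gamma: the chosen orientation of a passage agrees with that of tau when it
   is forwards along gamma or backwards against gamma. *)
Definition coeff (C : curve) (g : branch) : int :=
  \sum_(s <- C | pbranch s == g) (if along s == forwards s then 1 else -1).

(* From the corner c, anticlockwise, to the corner next_corner c. *)
Definition corner_arc (c : tcorner) : curve :=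
  let s : tside := (c.1, side_out c.2) in
  let k := short_of_tside s in
  [:: Passage (Bcorner c) true true;
      Passage (Bside s) true true;
      Passage (Bshort k) true true;
      Passage (Bshort (glue_short k)) false true;
      Passage (Bside (glue_tside s)) false true].
Definition vertex_loop (c : tcorner) : curve :=
  flatten [seq corner_arc c' | c' <- fingraph.orbit next_corner c].

(* A corner ((t, v), x) is an end of an edge of t, namely of the one labelled x
   at v; the ideal edges are the classes of the relation generated by
   exchanging the two ends and by gluing. *)
Definition other_end (c : tcorner) : tcorner :=
  let: ((t, v), x) := c in ((t, across x v), x).
Definition same_ideal_edge : rel tcorner :=
  connect [rel c c' | (c' == next_corner c) || (c' == other_end c)].

(* Curves are cyclic sequences, hence the rotation. *)
Definition edge_curve (c : tcorner) (C : curve) : Prop :=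
  exists j, C = rot j (vertex_loop c).

(* H_1 of the boundary with integral coefficients is computed with the cell
   decomposition dual to the triangulation.  A 1-chain is given by its flux out
   of each triangle through each of its sides. *)
Definition chain1 := {ffun tside -> int}.

Definition is_cycle1 (z : chain1) : Prop :=
  (forall s, z (glue_tside s) = - z s) /\
  (forall d : triangle, \sum_(k : side) z (d, k) = 0).

(* phi is a 2-chain, i.e. a function on the vertices of the triangulation,
   whose dual cells are oriented anticlockwise. *)
Definition is_boundary1 (z : chain1) : Prop :=
  exists2 phi : tcorner -> int,
    forall c, phi (next_corner c) = phi c &
    forall (d : triangle) (x y : letter), side_out x = side_in y ->
      z (d, side_out x) = phi (d, x) - phi (d, y).

Definition curve_chain (C : curve) : chain1 :=
  [ffun s => coeff C (Bside s)].

(* The algebraic intersection number, for the orientation of the boundary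
   given by anticlockwise rotation: the antisymmetrized simplicial cup product
   of the Poincare dual cocycles (the flux through each side) on the sum of
   the triangles. *)
Definition intersection (z w : chain1) : rat :=
  (\sum_(d : triangle)
     (z (d, AB) * w (d, BC) - z (d, BC) * w (d, AB)))%:~R / 2%:R.

Definition H1_symplectic_basis (nc : nat) (m l : 'I_nc -> curve) : Prop :=
  let M i := curve_chain (m i) in
  let L i := curve_chain (l i) in
  [/\ forall i j, intersection (M i) (L j) = (i == j)%:R,
      forall i j, intersection (M i) (M j) = 0,
      forall i j, intersection (L i) (L j) = 0 &
      forall z, is_cycle1 z ->
        exists! u : 'rV[int]_nc * 'rV[int]_nc,
          is_boundary1
            (z - \sum_(i < nc) (M i *~ u.1 0 i + L i *~ u.2 0 i))].

(* p_j, q_j, r_j are incidence C La j, incidence C Lb j, incidence C Lc j. *)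
Definition incidence (C : curve) (x : letter) (j : 'I_n) : int :=
  \sum_(v < 4) coeff C (Bcorner ((j, v), x)).

Definition col_tet (c : 'I_n.*2) : 'I_n :=
  Ordinal (etrans (ltn_half_double c n) (ltn_ord c)).

Definition curve_row (C : curve) : 'rV[int]_n.*2 :=
  \row_c (incidence C (if odd c then Lb else La) (col_tet c)
          - incidence C Lc (col_tet c)).

Definition sum_r (C : curve) : int := \sum_(j < n) incidence C Lc j.

Definition interleave (A : Type) (k : nat) (f g : 'I_k -> A) : seq A :=
  flatten [seq [:: f i; g i] | i <- enum 'I_k].

Section Matrices.
Variables (nc : nat).
Variables (C G : 'I_(n - nc) -> curve) (m l : 'I_nc -> curve).

Definition SY : 'M[int]_n.*2 :=
  \matrix_(i < n.*2) curve_row (nth [::] (interleave C G ++ interleave m l) i).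

Definition Cbar : 'cV[int]_n.*2 :=
  \col_(i < n.*2)
    nth 0 (interleave (fun i => 2 - sum_r (C i)) (fun=> 0) ++
           interleave (fun i => - sum_r (m i)) (fun i => - sum_r (l i))) i.

End Matrices.

Definition Jmx : 'M[int]_n.*2 :=
  \matrix_(i, j)
    (if ~~ odd i && (j == i.+1 :> nat) then 1
     else if odd i && (i == j.+1 :> nat) then -1 else 0).

(* The symplectic space V, in coordinates on the basis of the a_i, b_i. *)
Section Holonomy.
Variable R : realType.

Definition symp_space := 'M[R]_(n, 2).
Definition va (i : 'I_n) : symp_space := delta_mx i 0.
Definition vb (i : 'I_n) : symp_space := delta_mx i 1.
Definition vc (i : 'I_n) : symp_space := - va i - vb i.

Definition omega (u w : symp_space) : R :=
  \sum_(i < n) (u i 0 * w i 1 - u i 1 * w i 0).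

Lemma vabc i : va i + vb i + vc i = 0.
Proof. by rewrite /vc -opprD subrr. Qed.

Lemma omega_antisym u w : omega w u = - omega u w.
Proof.
rewrite /omega -sumrN; apply: eq_bigr => i _.
by rewrite opprB mulrC [X in _ - X]mulrC.
Qed.

Lemma omegaDr u w1 w2 : omega u (w1 + w2) = omega u w1 + omega u w2.
Proof.
rewrite /omega -big_split /=; apply: eq_bigr => i _.
by rewrite !mxE !mulrDr opprD addrACA.
Qed.

Lemma omegaZr a u w : omega u (a *: w) = a * omega u w.
Proof.
rewrite /omega mulr_sumr; apply: eq_bigr => i _.
by rewrite !mxE mulrBr !mulrA ![_ * a]mulrC.
Qed.

Lemma omega_ab i j : omega (va i) (vb j) = (i == j)%:R.
Proof.
rewrite /omega (bigD1 i) //= big1 => [|k /negPf ki]; rewrite !mxE ?ki.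
  by rewrite !eqxx !mul1r mul0r subr0 addr0 andbT.
by rewrite !mul0r subrr.
Qed.

Lemma omega_aa i j : omega (va i) (va j) = 0.
Proof.
by rewrite /omega big1 // => k _; rewrite !mxE !andbF mulr0 mul0r subrr.
Qed.

Lemma omega_bb i j : omega (vb i) (vb j) = 0.
Proof.
by rewrite /omega big1 // => k _; rewrite !mxE !andbF mulr0 mul0r subrr.
Qed.

Lemma omega_bc i j : omega (vb i) (vc j) = (i == j)%:R.
Proof.
rewrite /vc -[- va j]scaleN1r -[- vb j]scaleN1r omegaDr !omegaZr omega_bb mulr0.
by rewrite addr0 omega_antisym omega_ab mulrNN mul1r eq_sym.
Qed.

Lemma omega_ca i j : omega (vc i) (va j) = (i == j)%:R.
Proof.
rewrite omega_antisym /vc -[- va i]scaleN1r -[- vb i]scaleN1r omegaDr !omegaZr.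
by rewrite omega_aa mulr0 add0r omega_ab mulN1r opprK eq_sym.
Qed.

Definition branch_holonomy (g : branch) : symp_space :=
  match g with
  | Bcorner ((t, _), La) => va t
  | Bcorner ((t, _), Lb) => vb t
  | Bcorner ((t, _), Lc) => vc t
  | _ => 0
  end.

Definition holonomy (C : curve) : symp_space :=
  \sum_(g : branch) (coeff C g)%:~R *: branch_holonomy g.

Definition omega_h (C D : curve) : R := omega (holonomy C) (holonomy D).

End Holonomy.
End Triangulation.

Definition ipi (R : realType) : R[i] := (0 +i* pi)%C.

(* Main.v *)
Require Import Defs.
From mathcomp Require Import all_boot all_order all_fingroup all_algebra.
From mathcomp Require Import reals trigo complex.
From mathcomp Require Import zify.

Import Order.TTheory GRing.Theory Num.Theory.
Local Open Scope ring_scope.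

(* In the coordinates given by the a_i, b_i, the holonomy of a curve is its row
   and omega is the form with matrix J, so the hypotheses on the holonomies say
   that SY J SY^T = 2 J.  As J^2 = -1, the matrix - J SY^T J / 2 is then a right
   inverse of the square matrix SY, hence also a left inverse, and applying it
   to SY Z = i pi Cbar gives Z. *)

(** After division by [a], this is the fact that a one-sided inverse of a square matrix over a field
    is two-sided. *)
Lemma mulmx_scalar_comm (F : fieldType) k (a : F) (A B : 'M[F]_k) :
  a != 0 -> A *m B = a%:M -> B *m A = a%:M.
Proof.
move=> a0 AB; have /mulmx1C : (a^-1 *: A) *m B = 1%:M.
  by rewrite -scalemxAl AB scale_scalar_mx mulVf.
rewrite -scalemxAr => /(congr1 ( *:%R a)).
by rewrite scalerA mulfV // scale1r scale_scalar_mx mulr1.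
Qed.

Section DoubleIndex.
Context {n : nat}.

Lemma pair_index_subproof (t : 'I_n) (b : bool) : (t.*2 + b < n.*2)%N.
Proof. by have := ltn_ord t; case: b; lia. Qed.

(** Serves columns and rows alike: in a column [b] chooses between the coordinates on $\mathbf a_t$
    and $\mathbf b_t$, in a row of [SY] between a curve and its dual. *)
Definition pair_index (t : 'I_n) (b : bool) : 'I_n.*2 :=
  Ordinal (pair_index_subproof t b).

Lemma col_tet_pair_index t b : col_tet (pair_index t b) = t.
Proof. by apply: val_inj => /=; case: b; lia. Qed.

Lemma odd_pair_index t b : odd (pair_index t b) = b.
Proof. by rewrite /= oddD odd_double; case: b. Qed.

Lemma pair_index_split (i : 'I_n.*2) : pair_index (col_tet i) (odd i) = i.
Proof. by apply: val_inj => /=; lia. Qed.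

Lemma big_pair_index (V : nmodType) (F : 'I_n.*2 -> V) :
  \sum_i F i = \sum_t (F (pair_index t false) + F (pair_index t true)).
Proof.
rewrite (reindex (fun p : 'I_n * bool => pair_index p.1 p.2)) /=.
  rewrite -(pair_big predT predT (fun t b => F (pair_index t b))) /=.
  by apply: eq_bigr => t _; rewrite big_bool addrC.
exists (fun i => (col_tet i, odd i)) => [[t b] _|i _] /=.
  by rewrite col_tet_pair_index odd_pair_index.
exact: pair_index_split.
Qed.

(** The difference [b' - b] runs through exactly the four entries of the diagonal block of $J$, so
    parity tests on indices can be avoided from here on. *)
Lemma JmxE t b t' b' :
  Jmx n (pair_index t b) (pair_index t' b') = (t == t')%:R * (b'%:R - b%:R).
Proof.
rewrite mxE !odd_pair_index /= -val_eqE /=.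
case: b; case: b'; case: (eqVneq (nat_of_ord t) t') => [->|tt'] /=;
  do ?[case: eqP => ?]; by [lia | rewrite ?mul0r ?mul1r ?subrr ?sub0r ?subr0].
Qed.

(** The right-hand side has the shape of [omega], one term per tetrahedron, ready for a termwise
    comparison. *)
Lemma Jmx_form (u w : 'rV[int]_n.*2) :
  (u *m Jmx n *m w^T) 0 0 =
  \sum_t (u 0 (pair_index t false) * w 0 (pair_index t true)
          - u 0 (pair_index t true) * w 0 (pair_index t false)).
Proof.
have uJ t b : (u *m Jmx n) 0 (pair_index t b) =
    if b then u 0 (pair_index t false) else - u 0 (pair_index t true).
  rewrite mxE big_pair_index (bigD1 t) //= big1 => [|k /negPf kt].
    by rewrite !JmxE eqxx addr0; case: b => /=;
      rewrite !mul1r ?subrr ?subr0 ?sub0r ?mulr0 ?mulr1 ?mulrN1 ?addr0 ?add0r.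
  by rewrite !JmxE kt !mul0r !mulr0 addr0.
rewrite mxE big_pair_index; apply: eq_bigr => t _.
by rewrite !uJ !mxE mulNr addrC.
Qed.

Lemma Jmx_sqr : Jmx n *m Jmx n = - 1%:M.
Proof.
apply/matrixP=> i j; rewrite -(pair_index_split i) -(pair_index_split j).
move: (col_tet i) (odd i) (col_tet j) (odd j) => t b t' b'.
rewrite mxE big_pair_index (bigD1 t) //= big1 => [|k /negPf kt]; last first.
  by rewrite !JmxE eq_sym kt !mul0r addr0.
rewrite addr0 !JmxE eqxx !mxE -val_eqE /= -val_eqE /=.
case: b; case: b'; case: (eqVneq (nat_of_ord t) t') => [->|tt'] /=;
  do ?[case: eqP => ?]; by [lia | rewrite ?mul0r ?mul1r ?subrr ?sub0r ?subr0].
Qed.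

End DoubleIndex.

Lemma size_interleave (A : Type) k (f g : 'I_k -> A) :
  size (interleave f g) = k.*2.
Proof.
rewrite -[in RHS](size_enum_ord k) /interleave.
by elim: (enum _) => //= i s ->; rewrite doubleS.
Qed.

Lemma nth_interleave (A : Type) (x0 : A) k (f g : 'I_k -> A) (i : 'I_k)
  (b : bool) : nth x0 (interleave f g) (i.*2 + b) = (if b then g else f) i.
Proof.
(* Writing the argument of [f] or [g] as an entry of the enumeration too makes the claim one about
   an arbitrary sequence, to which induction applies. *)
rewrite -[in RHS](nth_ord_enum i i) /interleave.
have: (i < size (enum 'I_k))%N by rewrite size_enum_ord.
elim: (enum _) (nat_of_ord i) => //= j s IHs [|a] lt_as; first by case: (b).
by rewrite doubleS addSn /= IHs.
Qed.

Section Holonomy.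
Variables (R : realType) (n : nat).
Implicit Types (C D : curve n) (t : 'I_n).

(** Only the corner branches have nonzero holonomy, and it depends on the tetrahedron and the letter
    alone; summing the coefficients over the four vertices of a tetrahedron then produces the
    incidence numbers. *)
Lemma holonomyE C : holonomy R C =
  \sum_t ((incidence C La t)%:~R *: va R t + (incidence C Lb t)%:~R *: vb R t
          + (incidence C Lc t)%:~R *: vc R t).
Proof.
rewrite /holonomy.
rewrite (bigID (fun g : branch n => if g is Bcorner _ then true else false)) /=.
rewrite addrC big1 ?add0r; last by case=> //= *; rewrite scaler0.
rewrite (reindex_omap (@Bcorner n)
   (fun g => if g is Bcorner c then Some c else None)) /=; last by case.
under eq_bigl do rewrite eqxx.
pose F t v x := (coeff C (Bcorner ((t, v), x)))%:~R
  *: branch_holonomy R (Bcorner ((t, v), x)).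
rewrite (eq_bigr (fun c : triangle n * letter => F c.1.1 c.1.2 c.2)); last first.
  by move=> [[]].
rewrite -(pair_bigA _ (fun d x => F d.1 d.2 x)) /=.
rewrite -(pair_bigA _ (fun t v => \sum_x F t v x)) /=.
apply: eq_bigr => t _.
have sum_letter (f : letter -> symp_space n R) : \sum_x f x = f La + f Lb + f Lc.
  rewrite (bigD1 La) //= (bigD1 Lb) //= (bigD1 Lc) //= big1 ?addr0 ?addrA //.
  by case.
under eq_bigr do rewrite sum_letter.
rewrite !big_split /= /incidence !raddf_sum /= !scaler_suml.
by congr (_ + _ + _).
Qed.

(** The relation $\mathbf c_t = -\mathbf a_t - \mathbf b_t$ turns the incidences $(p, q, r)$ into
    $(p - r, q - r)$, the same reduction as the elimination of $Z''_t$. *)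
Lemma holonomy_coord C t (b : bool) :
  holonomy R C t (if b then 1 else 0) = (curve_row C 0 (pair_index t b))%:~R.
Proof.
rewrite holonomyE summxE (bigD1 t) //= big1 => [|k /negPf kt].
  rewrite [in RHS]mxE odd_pair_index col_tet_pair_index rmorphB /= !mxE !eqxx /=.
  by case: b; rewrite ?(eqxx, mulr1n, mulr1, mulr0, oppr0, subr0, sub0r, mulrN,
    addr0, add0r).
by rewrite !mxE eq_sym kt /= !mulr0 oppr0 addr0 mulr0 !addr0.
Qed.

Lemma omega_hE C D :
  omega_h R C D = ((curve_row C *m Jmx n *m (curve_row D)^T) 0 0)%:~R.
Proof.
rewrite Jmx_form rmorph_sum; apply: eq_bigr => t _.
by rewrite rmorphB !rmorphM /= -!holonomy_coord.
Qed.

End Holonomy.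

Section SymplecticMatrix.
Variables (R : realType) (n nc : nat).
Variables (C G : 'I_(n - nc) -> curve n) (m l : 'I_nc -> curve n).
Hypotheses
  (hCG : forall i j, omega_h R (C i) (G j) = 2 * (i == j)%:R)
  (hml : forall i j, omega_h R (m i) (l j) = 2 * (i == j)%:R)
  (hCC : forall i j, omega_h R (C i) (C j) = 0)
  (hGG : forall i j, omega_h R (G i) (G j) = 0)
  (hmm : forall i j, omega_h R (m i) (m j) = 0)
  (hll : forall i j, omega_h R (l i) (l j) = 0)
  (hCm : forall i j, omega_h R (C i) (m j) = 0)
  (hCl : forall i j, omega_h R (C i) (l j) = 0)
  (hGm : forall i j, omega_h R (G i) (m j) = 0)
  (hGl : forall i j, omega_h R (G i) (l j) = 0).

Let curves := interleave C G ++ interleave m l.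

(* Truncated subtraction makes this hold for nc > n too: then n - nc = 0 and the
   rows of SY come from m_i, l_i with i < n. *)
Lemma nth_curves (t : 'I_n) :
  (exists2 i : 'I_(n - nc), t = i :> nat &
     forall b : bool, nth [::] curves (t.*2 + b) = (if b then G else C) i) \/
  (exists2 i : 'I_nc, t = (n - nc + i)%N :> nat &
     forall b : bool, nth [::] curves (t.*2 + b) = (if b then l else m) i).
Proof.
have lt_tn := ltn_ord t; have [lt_t|le_t] := ltnP t (n - nc).
  left; exists (Ordinal lt_t) => // b.
  rewrite -(@nth_interleave _ [::]) nth_cat size_interleave /= ifT //.
  by case: b; lia.
have lt_t : (t - (n - nc) < nc)%N by lia.
right; exists (Ordinal lt_t) => [|b] /=; first by lia.
rewrite -(@nth_interleave _ [::]) nth_cat size_interleave ifF; last by case: b; lia.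
by congr nth => /=; case: b; lia.
Qed.

Lemma omega_h_curves (i j : 'I_n.*2) :
  omega_h R (nth [::] curves i) (nth [::] curves j) = 2 * (Jmx n i j)%:~R.
Proof.
(* The hypotheses give the pairing of curves of different kinds in one order only; antisymmetry
   supplies the other. *)
have anti C1 C2 : omega_h R C1 C2 = - omega_h R C2 C1.
  exact: omega_antisym.
rewrite -(pair_index_split i) -(pair_index_split j).
move: (col_tet i) (odd i) (col_tet j) (odd j) => t b t' b'.
rewrite JmxE -val_eqE /=.
pose simp := (subrr, subr0, sub0r, mulr0, mul0r, mul1r, mulr1, oppr0, mulrN1).
have [[k -> ->]|[k -> ->]] := nth_curves t;
  have [[k' -> ->]|[k' -> ->]] := nth_curves t'.
- rewrite val_eqE; case: b; case: b';
    rewrite ?hCC ?hGG ?[omega_h _ (G _) _]anti ?hCG ?[k' == k]eq_sym;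
    by case: eqP; rewrite /= ?simp.
(* Here the two curves come from the two different families, so one block index is below [n - nc]
   and the other is not: the entry of $J$ vanishes, as does the pairing. *)
- rewrite (_ : (k == _ :> nat) = false) ?mul0r ?mulr0.
    by case: b; case: b'.
  by have := ltn_ord k; lia.
- rewrite (_ : (_ == _ :> nat) = false) ?mul0r ?mulr0.
    by rewrite anti; case: b; case: b'; rewrite ?hCm ?hCl ?hGm ?hGl oppr0.
  by have := ltn_ord k'; lia.
- rewrite eqn_add2l val_eqE; case: b; case: b';
    rewrite ?hmm ?hll ?[omega_h _ (l _) _]anti ?hml ?[k' == k]eq_sym;
    by case: eqP; rewrite /= ?simp.
Qed.

Lemma SY_symplectic : SY C G m l *m Jmx n *m (SY C G m l)^T = 2 *: Jmx n.
Proof.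
(* The identity is between integers, but it is tested in [R], where [omega] takes its values. *)
apply/matrixP=> i j; apply: (@intr_inj R).
rewrite [in RHS]mxE rmorphM /= -omega_h_curves omega_hE; congr (_%:~R).
have rowSY (k : 'I_n.*2) : curve_row (nth [::] curves k) = row k (SY C G m l).
  by rewrite rowK.
rewrite !rowSY -row_mul tr_row.
by rewrite !mxE; apply: eq_bigr => k _; rewrite !mxE.
Qed.

Lemma SY_right_inverse :
  SY C G m l *m (- (Jmx n *m (SY C G m l)^T *m Jmx n)) = 2%:M.
Proof.
rewrite mulmxN !mulmxA SY_symplectic -scalemxAl Jmx_sqr scalerN opprK.
by rewrite scale_scalar_mx mulr1.
Qed.

End SymplecticMatrix.

Theorem theorem8p2 (R : realType) (n nc : nat) (T : triangulation n)
  (hconn : connected_triangulation T)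
  (hnc : (1 <= nc)%N)
  (htori : boundary_tori T nc)
  (e : 'I_(n - nc) -> tcorner n)
  (C G : 'I_(n - nc) -> curve n)
  (m l : 'I_nc -> curve n)
  (hC : forall i, edge_curve T (e i) (C i))
  (hdistinct : forall i j, i != j -> ~~ same_ideal_edge T (e i) (e j))
  (hG : forall i, oscillating T (G i))
  (hm : forall i, boundary_curve T (m i))
  (hl : forall i, boundary_curve T (l i))
  (hbasis : H1_symplectic_basis T m l)
  (hCG : forall i j, omega_h R (C i) (G j) = 2 * (i == j)%:R)
  (hml : forall i j, omega_h R (m i) (l j) = 2 * (i == j)%:R)
  (hCC : forall i j, omega_h R (C i) (C j) = 0)
  (hGG : forall i j, omega_h R (G i) (G j) = 0)
  (hmm : forall i j, omega_h R (m i) (m j) = 0)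
  (hll : forall i j, omega_h R (l i) (l j) = 0)
  (hCm : forall i j, omega_h R (C i) (m j) = 0)
  (hCl : forall i j, omega_h R (C i) (l j) = 0)
  (hGm : forall i j, omega_h R (G i) (m j) = 0)
  (hGl : forall i j, omega_h R (G i) (l j) = 0)
  (Z : 'cV[R[i]]_n.*2)
  (hZ : map_mx intr (SY C G m l) *m Z = ipi R *: map_mx intr (Cbar C m l)) :
  2 *: Z
    = ipi R *: (map_mx intr (- (Jmx n *m (SY C G m l)^T *m Jmx n))
                *m map_mx intr (Cbar C m l))
  /\ forall k, exists z : int, Z k 0 = (z%:~R / 2) * ipi R.
Proof.
have SYA := SY_right_inverse _ _ _ _ _ _ _
  hCG hml hCC hGG hmm hll hCm hCl hGm hGl.
set A := - _ in SYA *.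
have ASY : map_mx intr A *m map_mx intr (SY C G m l) = 2%:M :> 'M[R[i]]_n.*2.
  (* Exchanging the factors needs 2 to be invertible, so the integral identity is first carried over
     to the field [R[i]]. *)
  apply: mulmx_scalar_comm; first by rewrite pnatr_eq0.
  by rewrite -map_mxM SYA map_scalar_mx.
have Z2 : 2 *: Z = ipi R *: (map_mx intr A *m map_mx intr (Cbar C m l)).
  by rewrite scalemxAr -hZ mulmxA ASY mul_scalar_mx.
(* The witness is an integer because [A] and [Cbar] are integral; the only denominator comes from
   the factor 2 in front of [Z]. *)
split=> // k; exists ((A *m Cbar C m l) k 0).
have /matrixP/(_ k 0) := Z2; rewrite -map_mxM !mxE => Zk.
apply: (@mulfI _ 2); first by rewrite pnatr_eq0.
by rewrite Zk mulrA mulrCA mulfV ?pnatr_eq0 // mulr1 mulrC.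
Qed.
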